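(* Let $n=2^m$ with $m\ge 2$, let $\mathbf{e}_0,\dots,\mathbf{e}_{n-1}$ denote the standard basis vectors of $\mathbb{R}^n$, and define the cyclic-shift permutation matrix $\mathbf{P}$ by $\mathbf{P}\mathbf{e}_j=\mathbf{e}_{(j+1)\bmod n}$, $j=0,\dots,n-1$. Define $$\mathbf{W}_{\mathrm{ex}}:=\frac{1}{2m}\sum_{r=0}^{m-1}\left(\mathbf{P}^{2^r}+\mathbf{P}^{-2^r}\right).$$ Then $\mathbf{W}_{\mathrm{ex}}$ is symmetric and doubly stochastic. Let $\mathcal{G}_{\mathrm{ex}}$ denote its support graph, which has edges connecting nodes at cyclic distances $2^0,2^1,\dots,2^{m-1}$. Then $$D_{\mathcal{G}_{\mathrm{ex}}}=\left\lceil\frac{m}{2}\right\rceil=\Theta(\log n).$$ Moreover, $$1-\frac{2}{m}\le\lambda_{\mathbf{W}_{\mathrm{ex}}}\le 1-\frac{2-\sqrt2}{m}.$$ Consequently, $\tau_{\mathbf{W}_{\mathrm{ex}}}=\Theta(m)=\Theta(\log n)=\Theta(D_{\mathcal{G}_{\mathrm{ex}}})$.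
   Context: The support graph of a symmetric nonnegative matrix has an edge $\{i,j\}$, $i\ne j$, exactly when its $(i,j)$ entry is positive. With $\mathbf{J}=\mathbf{1}\mathbf{1}^\top/n$ and $\|\cdot\|_2$ the spectral norm, $\lambda_{\mathbf{W}}:=\|\mathbf{W}-\mathbf{J}\|_2$ and $\tau_{\mathbf{W}}:=1/(1-\lambda_{\mathbf{W}})$ when $\lambda_{\mathbf{W}}<1$. $D_{\mathcal{G}}$ is the graph diameter. $\Theta$ is as $m\to\infty$ (equivalently $n=2^m\to\infty$) with universal constants. *)

(* Defs.v *)
From HB Require Import structures.
From mathcomp Require Import all_boot all_order all_algebra all_fingroup.
From mathcomp Require Import all_classical all_reals all_analysis.

Set Implicit Arguments.
Unset Strict Implicit.
Unset Printing Implicit Defensive.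

Import Order.TTheory GRing.Theory Num.Theory.
Import numFieldNormedType.Exports.

Local Open Scope classical_set_scope.
Local Open Scope ring_scope.

(* `|x| on matrices is the max norm, hence the separate Euclidean norm. *)
Definition l2norm (R : realType) (n : nat) (x : 'cV[R]_n) : R :=
  Num.sqrt (\sum_(i < n) x i 0 ^+ 2).

(* The supremum is over a nonempty set (x = 0) that is bounded above. *)
Definition spectral_norm (R : realType) (n : nat) (A : 'M[R]_n) : R :=
  sup [set l2norm (A *m x) | x in [set x : 'cV[R]_n | l2norm x <= 1]].

Definition Jmx (R : realType) (n : nat) : 'M[R]_n :=
  n%:R^-1 *: (const_mx 1 *m (const_mx 1 : 'cV[R]_n)^T).

Definition lambda (R : realType) (n : nat) (W : 'M[R]_n) : R :=
  spectral_norm (W - Jmx R n).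

(* Meaningful only when lambda W < 1. *)
Definition tau (R : realType) (n : nat) (W : 'M[R]_n) : R :=
  1 / (1 - lambda W).

Definition doubly_stochastic (R : realType) (n : nat) (W : 'M[R]_n) : Prop :=
  [/\ forall i j, 0 <= W i j,
      forall i, \sum_j W i j = 1
    & forall j, \sum_i W i j = 1].

Definition support_graph (R : realType) (n : nat) (W : 'M[R]_n) : rel 'I_n :=
  [rel i j | (i != j) && (0 < W i j)].

(* Least number of edges of a walk from u to v.  A shortest walk has fewer than
   #|T| edges, so the search is complete; the value #|T| is returned exactly
   when v cannot be reached from u, and is never an actual distance. *)
Definition graph_dist (T : finType) (e : rel T) (u v : T) : nat :=
  find (fun k => [exists p : k.-tuple T, path e u p && (last u p == v)])
       (iota 0 #|T|).

(* For T nonempty, it equals #|T| exactly when e is not (strongly) connected. *)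
Definition diameter (T : finType) (e : rel T) : nat :=
  (\max_(u : T) \max_(v : T) graph_dist e u v)%N.

Definition cyclic_dist (n : nat) (i j : 'I_n) : nat :=
  minn ((i + (n - j)) %% n)%N ((j + (n - i)) %% n)%N.

Definition cyclic_shift (R : realType) (n : nat) : 'M[R]_n :=
  \matrix_(i, j) (i == ordS j)%:R.

Lemma cyclic_shift_delta (R : realType) (n : nat) (j : 'I_n) :
  cyclic_shift R n *m (delta_mx j 0 : 'cV[R]_n) = delta_mx (ordS j) 0.
Proof.
by rewrite -colE; apply/matrixP => i k; rewrite !mxE (ord1 k) eqxx andbT.
Qed.

Lemma cyclic_shift_unit (R : realType) (n : nat) :
  cyclic_shift R n \in unitmx.
Proof.
have -> : cyclic_shift R n = (perm_mx (perm (@ordS_inj n)))^T.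
  by apply/matrixP => i j; rewrite !mxE permE eq_sym.
by rewrite unitmx_tr unitmx_perm.
Qed.

(* invmx is a genuine inverse here by cyclic_shift_unit; the notation ^- is only
   available for matrices whose size is syntactically a successor. *)
Definition Wex (R : realType) (m : nat) : 'M[R]_(2 ^ m) :=
  let P := cyclic_shift R (2 ^ m) in
  (2 * m%:R)^-1 *: \sum_(r < m) (P ^+ (2 ^ r)%N + invmx P ^+ (2 ^ r)%N).

Definition Gex (R : realType) (m : nat) : rel 'I_(2 ^ m) :=
  support_graph (Wex R m).
Arguments Gex : clear implicits.

(* Main.v *)
Require Import Defs.
From HB Require Import structures.
From mathcomp Require Import all_boot all_order all_algebra.
From mathcomp Require Import all_classical all_reals all_analysis.
From mathcomp Require Import zify ring lra.

(** Two independent facts carry the theorem: a spectral estimate and a count of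
    signed binary digits.

    Spectral part. Let [P] be the shift and [Q_a = P ^+ (2 ^ a)]; thus [Q_a ^+
    2 = Q_(a+1)] and [Q_m = 1]. Every [Q_a] is an orthogonal matrix commuting
    with [W]. On the fixed space of [Q_(a+1)] the matrix [Q_a] is an
    involution, so this space is the orthogonal sum of the spaces [Q_a = 1] and
    [Q_a = -1]. Going from [a = m-1] down to [a = 0], a vector splits into
    orthogonal pieces, one in each space [Q_a = -1], plus a piece fixed by [P],
    which is constant and hence vanishes when the entries sum to zero. On [Q_a
    = -1] with [a > 0] one has [Q_(a-1) ^+ 2 = -1], so the summand [Q_(a-1) +
    Q_(a-1)^T] is zero, and the other [m-1] summands have norm at most [2]; on
    [P = -1] the sum is exactly the scalar [2 (m-2)]. In either case [W]
    contracts by [(m-1)/m] ([sqnorm_dyadic_sum_le], [lambda_Wex_le]), which is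
    stronger than the bound in the theorem because [1 <= sqrt 2]. The
    alternating vector satisfies [P x = -x], which gives the lower bound [1 -
    2/m] ([lambda_Wex_ge]).

    Diameter. A walk of length [k] from [u] to [v] writes [v - u] modulo [2 ^
    m] as a sum of [k] signed powers of two. Every integer can be written
    modulo [2 ^ m] with at most [uphalf m] of them, since each base 4 digit can
    be taken in [{-1, 0, 1, 2}] and costs at most one term
    ([short_signed_repr]). Conversely the residue with binary digits [...0101]
    needs [uphalf m] terms: in any signed representation the two lowest digits
    cost at least one more than the carry which they send to the next base 4
    position ([weight_alternating_bits]).

    The asymptotic equivalences follow, since for [m >= 2] both the diameter
    and [tau] lie between [m/2] and [m] while [ln (2 ^ m) = m * ln 2]. *)

Import Order.TTheory GRing.Theory Num.Theory.
Import numFieldNormedType.Exports.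

Set Implicit Arguments.
Unset Strict Implicit.
Unset Printing Implicit Defensive.

Local Open Scope classical_set_scope.
Local Open Scope ring_scope.

(** * The cyclic shift *)

Section Shift.
Variables (R : realType) (n : nat).
Local Notation P := (cyclic_shift R n).

Lemma cyclic_shiftX k (i j : 'I_n) :
  (P ^+ k) i j = (val i == (j + k) %% n)%N%:R.
Proof.
elim: k j => [|k IHk] j.
  by rewrite expr0 mxE addn0 modn_small // -val_eqE.
rewrite exprSr mxE (bigD1 (ordS j)) //= mxE eqxx mulr1 big1 ?addr0.
  by rewrite IHk /= modnDml addSnnS.
by move=> l ne_lj; rewrite mxE (negPf ne_lj) mulr0.
Qed.

Lemma cyclic_shift_orthogonal : P^T *m P = 1%:M.
Proof.
apply/matrixP => i j; rewrite !mxE (bigD1 (ordS j)) //= !mxE eqxx mulr1 big1.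
  by rewrite addr0 eq_sym (inj_eq (@ordS_inj n)).
by move=> l ne_lj; rewrite !mxE (negPf ne_lj) mulr0.
Qed.

Lemma invmx_cyclic_shift : invmx P = P^T.
Proof.
rewrite -[RHS]mulmx1 -(mulmxV (cyclic_shift_unit R n)) mulmxA.
by rewrite cyclic_shift_orthogonal mul1mx.
Qed.

Lemma cyclic_shift_const : P *m (const_mx 1 : 'cV[R]_n) = const_mx 1.
Proof.
apply/matrixP => i k; rewrite !mxE (bigD1 (ord_pred i)) //= !mxE ord_predK eqxx.
rewrite mulr1 big1 ?addr0 // => j ne_j; rewrite !mxE.
by case: (i =P _) ne_j => [->|]; rewrite ?ordSK ?eqxx ?mul0r.
Qed.

Lemma sum_cyclic_shiftX : \sum_(k < n) P ^+ k = const_mx 1.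
Proof.
apply/matrixP => i j; rewrite summxE mxE.
have lt_k : ((i + (n - j)) %% n < n)%N.
  by rewrite ltn_mod (leq_ltn_trans _ (ltn_ord i)).
have le_jn := ltnW (ltn_ord j).
rewrite (bigD1 (Ordinal lt_k)) //= cyclic_shiftX modnDmr.
have -> : (j + (i + (n - j)) = i + n)%N by lia.
rewrite modnDr modn_small // eqxx big1 ?addr0 // => k ne_k.
rewrite cyclic_shiftX; case: eqP => // iE; case/eqP: ne_k; apply: val_inj => /=.
rewrite iE modnDml (_ : j + k + (n - j) = k + n)%N; last by lia.
by rewrite modnDr modn_small.
Qed.

End Shift.

(** * Orthogonal decompositions and dyadic sums *)

Section SquaredNorm.
Variables (R : realType) (n : nat).
Implicit Types (x y : 'cV[R]_n) (P : 'M[R]_n).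

Definition sqnorm x : R := \sum_(i < n) x i 0 ^+ 2.

Lemma sqnorm_ge0 x : 0 <= sqnorm x.
Proof. by apply: sumr_ge0 => i _; apply: sqr_ge0. Qed.

Lemma sqnormE x : sqnorm x = (x^T *m x) 0 0.
Proof. by rewrite mxE; apply: eq_bigr => i _; rewrite mxE expr2. Qed.

Lemma sqnormZ a x : sqnorm (a *: x) = a ^+ 2 * sqnorm x.
Proof.
by rewrite /sqnorm mulr_sumr; apply: eq_bigr => i _; rewrite mxE exprMn.
Qed.

Lemma l2normZ a x : l2norm (a *: x) = `|a| * l2norm x.
Proof.
by rewrite /l2norm -/(sqnorm _) sqnormZ sqrtrM ?sqr_ge0 // sqrtr_sqr.
Qed.

Lemma sqnorm_isometry P x : P^T *m P = 1%:M -> sqnorm (P *m x) = sqnorm x.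
Proof.
move=> PTP; rewrite !sqnormE trmx_mul -mulmxA [P^T *m _]mulmxA PTP.
by rewrite mul1mx.
Qed.

Lemma sum_sqr_sub (I : finType) (A : pred I) (a : I -> R) (c : R) :
  \sum_(i | A i) (a i - c) ^+ 2
    = \sum_(i | A i) a i ^+ 2 - 2 * c * \sum_(i | A i) a i + #|A|%:R * c ^+ 2.
Proof.
rewrite (eq_bigr (fun i => a i ^+ 2 + (- (2 * c) * a i + c ^+ 2))).
  by rewrite !big_split /= -mulr_sumr sumr_const -mulr_natl; ring.
by move=> i _; ring.
Qed.

(** Nonnegativity of the variance of [a] over [A]. *)
Lemma sqr_sum_le (I : finType) (A : pred I) (a : I -> R) :
  (\sum_(i | A i) a i) ^+ 2 <= #|A|%:R * \sum_(i | A i) a i ^+ 2.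
Proof.
set S := \sum_(i | A i) a i; set T := \sum_(i | A i) _; set N := #|A|%:R.
have [A0|A_gt0] := posnP #|A|.
  have A0' := card0_eq A0.
  by rewrite /S /N A0 mul0r big_pred0 ?expr0n.
have N_gt0 : 0 < N by rewrite ltr0n.
have : 0 <= \sum_(i | A i) (a i - S / N) ^+ 2.
  by apply: sumr_ge0 => i _; apply: sqr_ge0.
rewrite sum_sqr_sub -/S -/T -/N (_ : _ + _ = T - S ^+ 2 / N).
  by rewrite subr_ge0 ler_pdivrMr // mulrC.
by field; rewrite gt_eqF.
Qed.

Lemma sqnorm_sum_le (I : finType) (A : pred I) (v : I -> 'cV[R]_n) :
  sqnorm (\sum_(i | A i) v i) <= #|A|%:R * \sum_(i | A i) sqnorm (v i).
Proof.
rewrite exchange_big mulr_sumr; apply: ler_sum => i _ /=.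
by rewrite summxE; apply: sqr_sum_le.
Qed.

Lemma sqnormD_le x y : sqnorm (x + y) <= 2 * (sqnorm x + sqnorm y).
Proof.
rewrite -big_split /= mulr_sumr; apply: ler_sum => i _.
by rewrite mxE; have := sqr_ge0 (x i 0 - y i 0); nra.
Qed.

(** An isometry [P] as below exchanges [x + y] and [x - y], so these two
    vectors have the same norm and the parallelogram law becomes Pythagoras. *)
Lemma sqnormD_eigen P x y : P^T *m P = 1%:M -> P *m x = x -> P *m y = - y ->
  sqnorm (x + y) = sqnorm x + sqnorm y.
Proof.
move=> PTP Px Py.
have xy0 : sqnorm (x + y) = sqnorm (x - y).
  by rewrite -[LHS](sqnorm_isometry _ PTP) mulmxDr Px Py.
have -> : sqnorm (x + y) = (sqnorm (x + y) + sqnorm (x - y)) / 2.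
  by rewrite -xy0; field.
rewrite /sqnorm -!big_split /= mulr_suml; apply: eq_bigr => i _.
by rewrite !mxE; field.
Qed.

End SquaredNorm.

Section Dyadic.
Variables (R : realType) (n m : nat) (P : 'M[R]_n).
Hypothesis (PTP : P^T *m P = 1%:M).
Implicit Types (x y z : 'cV[R]_n).

Definition dyadic_term r : 'M[R]_n := P ^+ (2 ^ r)%N + P^T ^+ (2 ^ r)%N.

Definition dyadic_sum : 'M[R]_n := \sum_(r < m) dyadic_term r.

Lemma trmxX k : (P ^+ k)^T = P^T ^+ k.
Proof. by elim: k => [|k IHk]; rewrite ?trmx1 // exprS trmx_mul IHk exprSr. Qed.

Lemma orthX k : (P ^+ k)^T *m P ^+ k = 1%:M.
Proof.
elim: k => [|k IHk]; first by rewrite trmx1 mulmx1.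
by rewrite exprS trmx_mul -mulmxA [P^T *m _]mulmxA PTP mul1mx.
Qed.

Lemma dyadic_sum_commX k : dyadic_sum *m P ^+ k = P ^+ k *m dyadic_sum.
Proof.
apply: esym; apply: commr_sum => r _; apply: commrD.
  by apply: commrX; apply/commr_sym/commrX.
apply: commrX; apply/commr_sym/commrX.
exact: etrans PTP (esym (mulmx1C PTP)).
Qed.

Lemma fixed_pow Q k x : Q *m x = x -> Q ^+ k *m x = x.
Proof.
by move=> Qx; elim: k => [|k IHk]; rewrite ?mul1mx // exprS -mulmxA IHk.
Qed.

Lemma trmx_fixed Q x : Q^T *m Q = 1%:M -> Q *m x = x -> Q^T *m x = x.
Proof. by move=> QTQ Qx; rewrite -{1}Qx mulmxA QTQ mul1mx. Qed.

Lemma trmx_antifixed Q x : Q^T *m Q = 1%:M -> Q *m x = - x -> Q^T *m x = - x.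
Proof.
by move=> QTQ Qx; rewrite -[x in LHS]opprK -Qx mulmxN mulmxA QTQ mul1mx.
Qed.

Lemma dyadic_term_fixed a r x : (a <= r)%N ->
  P ^+ (2 ^ a)%N *m x = x -> dyadic_term r *m x = 2 *: x.
Proof.
move=> le_ar Px; have Qx : P ^+ (2 ^ r)%N *m x = x.
  by rewrite -(subnKC le_ar) expnD exprM fixed_pow.
rewrite mulmxDl Qx -trmxX (trmx_fixed (orthX _) Qx).
by rewrite scaler_nat mulr2n.
Qed.

(** With [Q = P ^+ (2 ^ a)], the hypothesis says [Q ^+ 2 x = - x], so that the
    inverse [Q^T] sends [x] to [- (Q x)]. *)
Lemma dyadic_term_eq0 a x :
  P ^+ (2 ^ a.+1)%N *m x = - x -> dyadic_term a *m x = 0.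
Proof.
rewrite expnS mulnC exprM /dyadic_term; set Q := P ^+ (2 ^ a)%N => QQx.
have QTx : Q^T *m x = - (Q *m x).
  rewrite -[x in LHS]opprK -QQx mulmxN expr2 mulmxA.
  by rewrite -[Q * Q]/(Q *m Q) mulmxA orthX mul1mx.
by rewrite -trmxX mulmxDl QTx subrr.
Qed.

Lemma sqnorm_dyadic_term r x : sqnorm (dyadic_term r *m x) <= 4 * sqnorm x.
Proof.
rewrite mulmxDl; apply: le_trans (sqnormD_le _ _) _.
rewrite sqnorm_isometry ?orthX // sqnorm_isometry; first by lra.
by rewrite -trmxX trmxK; apply: mulmx1C; exact: orthX.
Qed.

(** The term of index 0 contributes the scalar [-2]; all even powers of [P] fix
    [x], so each of the other [m - 1] terms contributes [2]. *)
Lemma dyadic_sum_antifixed x : (0 < m)%N -> P *m x = - x ->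
  dyadic_sum *m x = (2 * (m%:R - 2)) *: x.
Proof.
move=> m_gt0 Px; rewrite mulmx_suml (bigD1 (Ordinal m_gt0)) //=.
rewrite mulmxDl -trmxX (trmx_antifixed (orthX _)) ?expr1 //.
rewrite Px (eq_bigr (fun => 2 *: x)) => [|r r_neq0].
  rewrite sumr_const cardC1 card_ord -scaler_nat scalerA -opprD -mulr2n.
  rewrite -scaler_nat -scaleNr -scalerDl -subn1 natrB //; congr (_ *: _); ring.
apply: (@dyadic_term_fixed 1).
  by rewrite lt0n -(inj_eq val_inj) in r_neq0 *.
by rewrite expr2 -mulmxA Px mulmxN Px opprK.
Qed.

(** One of the [m] terms vanishes on [x], or, when [a = 0], two of them cancel:
    this missing term is the origin of the spectral gap. *)
Lemma sqnorm_dyadic_antifixed a x : (2 <= m)%N -> (a < m)%N ->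
  P ^+ (2 ^ a)%N *m x = - x ->
  sqnorm (dyadic_sum *m x) <= (2 * (m%:R - 1)) ^+ 2 * sqnorm x.
Proof.
move=> m_ge2 lt_am Px.
have m_ge2R : 2 <= m%:R :> R by rewrite ler_nat.
have x_ge0 := sqnorm_ge0 x.
case: a lt_am Px => [m_gt0|a lt_am] Px.
  rewrite (dyadic_sum_antifixed m_gt0 Px) sqnormZ.
  by apply: ler_wpM2r => //; nra.
rewrite mulmx_suml (bigD1 (Ordinal (ltnW lt_am))) //=.
rewrite dyadic_term_eq0 // add0r.
apply: le_trans (sqnorm_sum_le _ _) _.
rewrite cardC1 card_ord -subn1 natrB ?(ltnW m_ge2) //.
apply: (@le_trans _ _ ((m%:R - 1) * ((m%:R - 1) * (4 * sqnorm x))));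
  last by nra.
apply: ler_wpM2l; first by lra.
apply: (@le_trans _ _ (\sum_(i < m | i != Ordinal (ltnW lt_am)) 4 * sqnorm x)).
  by apply: ler_sum => r _; apply: sqnorm_dyadic_term.
rewrite sumr_const cardC1 card_ord -[X in X <= _]mulr_natl.
by rewrite -subn1 natrB // ltnW.
Qed.

(** The hypothesis on [\sum_k P ^+ k] says that [x] has no component fixed by
    [P]. The induction is on the exponent [a] of a power [P ^+ (2 ^ a)] fixing
    [x]: the projections of [x] on the eigenspaces of [P ^+ (2 ^ a)] for [1]
    and [-1] stay orthogonal after applying the sum, as it commutes with [P].
*)
Lemma sqnorm_dyadic_sum_le x : (2 <= m)%N -> P ^+ (2 ^ m)%N *m x = x ->
  (\sum_(k < 2 ^ m) P ^+ k) *m x = 0 ->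
  sqnorm (dyadic_sum *m x) <= (2 * (m%:R - 1)) ^+ 2 * sqnorm x.
Proof.
move=> m_ge2; elim: {1 3}m (leqnn m) x => [_ x Px|a IHa lt_am x Px] avg0.
  suff -> : x = 0.
    by rewrite mulmx0 /sqnorm big1 ?mulr0 // => i _; rewrite mxE expr0n.
  move: avg0; rewrite mulmx_suml (eq_bigr (fun => x)) => [|k _].
    rewrite sumr_const card_ord -scaler_nat => /eqP.
    by rewrite scaler_eq0 pnatr_eq0 expn_eq0 => /eqP.
  exact: fixed_pow.
set Q := P ^+ (2 ^ a)%N.
set y := 2^-1 *: (x + Q *m x); set z := 2^-1 *: (x - Q *m x).
have QQx : Q *m (Q *m x) = x.
  by rewrite mulmxA -[Q *m Q]/(Q * Q) -expr2 -exprM mulnC -expnS.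
have Qy : Q *m y = y by rewrite -scalemxAr mulmxDr QQx addrC.
have Qz : Q *m z = - z by rewrite -scalemxAr mulmxBr QQx -scalerN opprB.
have xE : x = y + z.
  rewrite -scalerDr addrACA subrr addr0 -mulr2n -[x *+ 2]scaler_nat scalerA.
  by rewrite mulVf ?scale1r // pnatr_eq0.
have avgy0 : (\sum_(k < 2 ^ m) P ^+ k) *m y = 0.
  rewrite -scalemxAr mulmxDr avg0 add0r mulmxA.
  have -> : (\sum_(k < 2 ^ m) P ^+ k) *m Q = Q *m (\sum_(k < 2 ^ m) P ^+ k).
    apply: esym; apply: commr_sum => k _.
    by apply: commrX; apply/commr_sym/commrX.
  by rewrite -mulmxA avg0 mulmx0 scaler0.
rewrite {1}xE mulmxDr (@sqnormD_eigen _ _ Q) ?orthX //; first last.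
- by rewrite mulmxA -dyadic_sum_commX -mulmxA Qz mulmxN.
- by rewrite mulmxA -dyadic_sum_commX -mulmxA Qy.
rewrite xE (sqnormD_eigen (orthX _) Qy Qz) mulrDr; apply: lerD.
  exact: IHa (ltnW lt_am) _ Qy avgy0.
exact: sqnorm_dyadic_antifixed lt_am Qz.
Qed.

End Dyadic.

(** * The spectral norm *)

Section SpectralNorm.
Variables (R : realType) (n : nat).
Implicit Types (A : 'M[R]_n) (x y : 'cV[R]_n) (c : R).

Lemma l2norm_le c x y : 0 <= c -> sqnorm y <= c ^+ 2 * sqnorm x ->
  l2norm y <= c * l2norm x.
Proof.
move=> c_ge0 le_yx; rewrite -(ger0_norm c_ge0) -l2normZ.
by apply: ler_wsqrtr; rewrite -/(sqnorm _) -/(sqnorm _) sqnormZ.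
Qed.

(** The real-valued supremum is meaningful only over a set that is bounded
    above; this supplies the bound. *)
Lemma spectral_norm_ub A c : 0 <= c ->
  (forall x, l2norm (A *m x) <= c * l2norm x) ->
  ubound [set l2norm (A *m x) | x in [set x : 'cV[R]_n | l2norm x <= 1]] c.
Proof.
move=> c_ge0 leAc _ [x /= x_le1 <-]; apply: le_trans (leAc x) _.
by rewrite -[leRHS]mulr1 ler_wpM2l.
Qed.

Lemma spectral_norm_le A c : 0 <= c ->
  (forall x, l2norm (A *m x) <= c * l2norm x) -> spectral_norm A <= c.
Proof.
move=> c_ge0 leAc; apply: ge_sup; last exact: spectral_norm_ub.
exists (l2norm (A *m 0)), 0.
  by rewrite /= -(scale0r (0 : 'cV[R]_n)) l2normZ normr0 mul0r ler01.
by [].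
Qed.

Lemma eigenvalue_le_spectral_norm A c x mu : 0 <= c ->
  (forall y, l2norm (A *m y) <= c * l2norm y) ->
  0 < l2norm x -> A *m x = mu *: x -> `|mu| <= spectral_norm A.
Proof.
move=> c_ge0 leAc x_gt0 Ax; apply: ub_le_sup.
  by exists c; apply: spectral_norm_ub.
exists ((l2norm x)^-1 *: x) => /=.
  by rewrite l2normZ ger0_norm ?invr_ge0 ?(ltW x_gt0) // mulVf ?lexx ?gt_eqF.
rewrite -scalemxAr Ax scalerA mulrC -scalerA l2normZ l2normZ.
by rewrite [`|_^-1|]ger0_norm ?invr_ge0 ?(ltW x_gt0) // mulVf ?gt_eqF // mulr1.
Qed.

Lemma JmxE i j : Jmx R n i j = n%:R^-1.
Proof. by rewrite !mxE big_ord1 !mxE !mulr1. Qed.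

(** [Jmx] replaces each entry by the mean, and the mean of squares about the
    mean is at most the mean of squares about 0. *)
Lemma sqnorm_center_le x : sqnorm (x - Jmx R n *m x) <= sqnorm x.
Proof.
set S := \sum_i x i 0.
have xE i : (x - Jmx R n *m x) i 0 = x i 0 - S / n%:R.
  rewrite !mxE mulr_suml; congr (_ - _); apply: eq_bigr => j _.
  by rewrite JmxE mulrC.
rewrite /sqnorm (eq_bigr (fun i => (x i 0 - S / n%:R) ^+ 2)) => [|i _];
  last by rewrite xE.
rewrite sum_sqr_sub card_ord -/S.
have [->|n_neq0] := eqVneq (n%:R : R) 0; first by rewrite invr0; nra.
rewrite (_ : _ + _ = \sum_i x i 0 ^+ 2 - S ^+ 2 / n%:R); last by field.
by rewrite gerBl divr_ge0 ?sqr_ge0 ?ler0n.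
Qed.

End SpectralNorm.

(** * The spectrum of the exponential-graph matrix *)

Lemma cyclic_shift_sum_eq0 (R : realType) (n : nat) (x : 'cV[R]_n) :
  Jmx R n *m x = 0 -> (\sum_(k < n) cyclic_shift R n ^+ k) *m x = 0.
Proof.
move=> Jx; have -> : \sum_(k < n) cyclic_shift R n ^+ k = n%:R *: Jmx R n.
  rewrite sum_cyclic_shiftX; apply/matrixP => i j.
  rewrite mxE mxE JmxE divff // pnatr_eq0 -lt0n.
  by rewrite (leq_ltn_trans _ (ltn_ord i)).
by rewrite -scalemxAl Jx scaler0.
Qed.

Section Exponential.
Variables (R : realType) (m : nat).
Hypothesis m_ge2 : (2 <= m)%N.
Local Notation n := (2 ^ m)%N.
Local Notation P := (cyclic_shift R n).
Local Notation W := (Wex R m).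

Lemma WexE : W = (2 * m%:R)^-1 *: dyadic_sum m P.
Proof. by rewrite /Wex invmx_cyclic_shift. Qed.

Lemma Wex_sym : W^T = W.
Proof.
rewrite WexE linearZ /=; congr (_ *: _); rewrite linear_sum /=.
by apply: eq_bigr => r _; rewrite /dyadic_term linearD /= !trmxX trmxK addrC.
Qed.

Lemma Wex_entry i j : W i j = (2 * m%:R)^-1 *
  \sum_(r < m) ((val i == (j + 2 ^ r) %% n)%N%:R
                + (val j == (i + 2 ^ r) %% n)%N%:R).
Proof.
rewrite WexE !mxE; congr (_ * _); rewrite summxE; apply: eq_bigr => r _.
by rewrite /dyadic_term -trmxX !mxE !cyclic_shiftX.
Qed.

Let m_ge2R : 2 <= m%:R :> R. Proof. by rewrite ler_nat. Qed.

Let m_neq0 : m%:R != 0 :> R. Proof. by rewrite pnatr_eq0 -lt0n ltnW. Qed.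

Lemma Wex_const : W *m (const_mx 1 : 'cV[R]_n) = const_mx 1.
Proof.
rewrite WexE -scalemxAl mulmx_suml (eq_bigr (fun => 2 *: const_mx 1)) => [|r _].
  rewrite sumr_const card_ord -[X in _ *: X]scaler_nat !scalerA mulrC mulrA.
  by rewrite (_ : _ * _ = 1) ?scale1r //; field.
apply: (@dyadic_term_fixed _ _ _ (cyclic_shift_orthogonal R n) 0) => //.
by rewrite expr1 cyclic_shift_const.
Qed.

Lemma Wex_doubly_stochastic : doubly_stochastic W.
Proof.
have row i : \sum_j W i j = 1.
  have /matrixP/(_ i 0) := Wex_const; rewrite !mxE => <-.
  by apply: eq_bigr => j _; rewrite !mxE mulr1.
split=> // [i j|j].
  rewrite Wex_entry mulr_ge0 ?invr_ge0 ?mulr_ge0 ?ler0n //.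
  by apply: sumr_ge0 => r _; rewrite addr_ge0 ?ler0n.
by rewrite -(row j); apply: eq_bigr => i _; rewrite -{1}Wex_sym mxE.
Qed.

Lemma Wex_center (x : 'cV[R]_n) : (W - Jmx R n) *m x = W *m (x - Jmx R n *m x).
Proof.
rewrite mulmxBl mulmxBr mulmxA; congr (_ - _ *m x).
by rewrite /Jmx -scalemxAr mulmxA Wex_const.
Qed.

Lemma Jmx_idem : Jmx R n *m Jmx R n = Jmx R n.
Proof.
apply/matrixP => i j; rewrite mxE JmxE (eq_bigr (fun => (n%:R^-1) ^+ 2)).
  rewrite sumr_const card_ord -mulr_natl; field.
  by rewrite pnatr_eq0 expn_eq0.
by move=> k _; rewrite !JmxE expr2.
Qed.

(** Since [W] fixes constants, [W - J] acts on [x] as [W] acts on the centered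
    vector [x - J x], which has no component fixed by the shift. *)
Lemma Wex_sub_Jmx_le (x : 'cV[R]_n) :
  l2norm ((W - Jmx R n) *m x) <= ((m%:R - 1) / m%:R) * l2norm x.
Proof.
rewrite Wex_center; set y := x - _.
apply: l2norm_le; first by apply: divr_ge0; have := m_ge2R; lra.
apply: (@le_trans _ _ (((m%:R - 1) / m%:R) ^+ 2 * sqnorm y)); last first.
  by rewrite ler_wpM2l ?sqr_ge0 // sqnorm_center_le.
rewrite WexE -scalemxAl sqnormZ.
have -> : (m%:R - 1) / m%:R = (2 * m%:R)^-1 * (2 * (m%:R - 1)) :> R by field.
rewrite [X in _ <= X * _]exprMn -[leRHS]mulrA.
apply: ler_wpM2l; first exact: sqr_ge0.
apply: sqnorm_dyadic_sum_le => //; first exact: cyclic_shift_orthogonal.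
  suff -> : P ^+ n = 1 by rewrite mul1mx.
  apply/matrixP => i j; rewrite cyclic_shiftX modnDr modn_small //.
  by rewrite mxE -val_eqE.
by apply: cyclic_shift_sum_eq0; rewrite mulmxBr mulmxA Jmx_idem subrr.
Qed.

Definition alternating_vector : 'cV[R]_n := \col_i (-1) ^+ i.

(** The sign of [i] survives the wrap-around because [2 ^ m] is even. *)
Lemma cyclic_shift_alternating : P *m alternating_vector = - alternating_vector.
Proof.
apply/matrixP => i k; rewrite !mxE (bigD1 (ord_pred i)) //= !mxE ord_predK eqxx.
rewrite mul1r big1 ?addr0 => [|j ne_j]; last first.
  by rewrite !mxE; case: (i =P _) ne_j => [->|]; rewrite ?ordSK ?eqxx ?mul0r.
rewrite -{2}(ord_predK i); set j := ord_pred i.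
have sgn_mod l : (-1) ^+ (l %% n)%N = (-1) ^+ l :> R.
  by rewrite -signr_odd odd_mod ?signr_odd // oddX; case: (m) m_ge2.
by rewrite [val (ordS j)]/= sgn_mod exprS mulN1r opprK.
Qed.

Lemma lambda_Wex_le : lambda W <= (m%:R - 1) / m%:R.
Proof.
by apply: spectral_norm_le Wex_sub_Jmx_le; apply: divr_ge0; have := m_ge2R; lra.
Qed.

(** The alternating vector is an eigenvector of the shift for [-1]; it is
    orthogonal to the constants, so [J] kills it. *)
Lemma lambda_Wex_ge : (m%:R - 2) / m%:R <= lambda W.
Proof.
have alt_norm : sqnorm alternating_vector = n%:R.
  rewrite /sqnorm (eq_bigr (fun => 1)) ?sumr_const ?card_ord // => i _.
  by rewrite !mxE sqrr_sign.
apply: le_trans (ler_norm _) _.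
apply: (eigenvalue_le_spectral_norm _ Wex_sub_Jmx_le (x := alternating_vector)).
- by apply: divr_ge0; have := m_ge2R; lra.
- by rewrite sqrtr_gt0 -/(sqnorm _) alt_norm ltr0n expn_gt0.
have Jalt : Jmx R n *m alternating_vector = 0.
  (* J is unchanged by P on its right while P negates the vector. *)
  have JP : Jmx R n *m P = Jmx R n.
    rewrite /Jmx -scalemxAl -mulmxA; congr (_ *: (_ *m _)).
    rewrite -[LHS]trmxK trmx_mul trmxK; congr (_^T).
    exact: trmx_fixed (cyclic_shift_orthogonal R n) (cyclic_shift_const R n).
  have : Jmx R n *m alternating_vector = - (Jmx R n *m alternating_vector).
    by rewrite -mulmxN -cyclic_shift_alternating mulmxA JP.
  move/eqP; rewrite -addr_eq0 -mulr2n -scaler_nat scaler_eq0 pnatr_eq0.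
  by move/eqP.
rewrite mulmxBl Jalt subr0 WexE -scalemxAl.
rewrite (dyadic_sum_antifixed (cyclic_shift_orthogonal R n) (ltnW m_ge2)).
  by rewrite scalerA; congr (_ *: _); field.
exact: cyclic_shift_alternating.
Qed.

End Exponential.

(** * Distances in finite graphs *)

Section GraphDist.
Variables (T : finType) (e : rel T).

Lemma graph_dist_le u v p : path e u p -> last u p = v ->
  (graph_dist e u v <= size p)%N.
Proof.
move=> ep lp; rewrite /graph_dist; set a := fun k : nat => _.
have ap : a (size p) by apply/existsP; exists (in_tuple p); rewrite ep lp eqxx.
have [lt_pT|le_Tp] := ltnP (size p) #|T|; last first.
  by apply: leq_trans (find_size _ _) _; rewrite size_iota.
rewrite leqNgt; apply/negP => /(before_find 0%N).
by rewrite nth_iota // add0n ap.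
Qed.

(** The bound on [k] covers the case where no walk exists and the distance
    takes its conventional value [#|T|]. *)
Lemma graph_dist_ge u v k : (k <= #|T|)%N ->
  (forall p, path e u p -> last u p = v -> (k <= size p)%N) ->
  (k <= graph_dist e u v)%N.
Proof.
move=> le_kT walk_ge; rewrite /graph_dist; set a := fun k : nat => _.
have [has_a|] := boolP (has a (iota 0 #|T|)); last first.
  by move/hasNfind->; rewrite size_iota.
have := nth_find 0%N has_a.
have := has_a; rewrite has_find size_iota => lt_find.
rewrite nth_iota // add0n => /existsP[p /andP[ep /eqP lp]].
by have := walk_ge _ ep lp; rewrite size_tuple.
Qed.

End GraphDist.

(** * Signed binary representations *)

(** The list contains digits of arbitrary sign and size, lowest first: the
    digit at position [r] records how many steps of length [2 ^ r] a walk
    makes, counted with sign. *)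
Fixpoint binary_value (cs : seq int) : int :=
  if cs is c :: cs' then c + 2 * binary_value cs' else 0.

Definition weight (cs : seq int) : nat := (\sum_(c <- cs) `|c|)%N.

Lemma binary_value_add (s : bool) (r : nat) cs : exists cs',
  binary_value cs' = binary_value cs + (-1) ^+ s * (2 ^ r)%N%:Z /\
  (weight cs' <= (weight cs).+1)%N.
Proof.
rewrite /weight; elim: r cs => [|r IHr] cs.
  exists ((head 0 cs + (-1) ^+ s) :: behead cs).
  by case: cs => [|c cs]; rewrite /= ?big_cons ?big_nil; case: s => /=; lia.
case: (IHr (behead cs)) => cs' [val_cs' wt_cs'].
exists (head 0 cs :: cs'); case: cs wt_cs' val_cs' => [|c cs] /=;
  rewrite ?big_cons ?big_nil /= expnS; case: (s) => /=; lia.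
Qed.

(** The number whose [m] binary digits are [...0101]. *)
Fixpoint alternating_bits (m : nat) : int :=
  match m with 0 => 0 | 1 => 1 | m'.+2 => 1 + 4 * alternating_bits m' end.

(** Induction in steps of two digits. The two lowest digits satisfy
    [c0 + 2 * c1 = 1 + 4 * t'], and the carry [t'] is added to the third digit.
    This equation forces [|t'| + 1 <= |c0| + |c1|], so removing the two digits
    saves at least one unit of weight even after paying for the carry. *)
Lemma weight_alternating_bits m cs t :
  binary_value cs = alternating_bits m + (2 ^ m)%N%:Z * t ->
  (uphalf m <= weight cs)%N.
Proof.
suff H : forall k m cs t, (m <= k)%N ->
  binary_value cs = alternating_bits m + (2 ^ m)%N%:Z * t ->
  (uphalf m <= weight cs)%N.
  by apply: (H m).
rewrite /weight; elim=> [|k IHk] [|[|m']] {}cs {}t // le_mk.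
  case: cs => [|c [|d cs]]; rewrite /= ?big_cons ?big_nil; lia.
have [c0 [c1 [c2 [cs' [-> ->]]]]] : exists c0 c1 c2 cs',
  [/\ binary_value cs = c0 + 2 * (c1 + 2 * binary_value (c2 :: cs'))
   & (\sum_(c <- cs) `|c| = `|c0| + `|c1| + \sum_(c <- c2 :: cs') `|c|)%N].
  case: cs => [|c0 [|c1 [|c2 cs]]]; [exists 0, 0, 0, [::]|
    exists c0, 0, 0, [::]|exists c0, c1, 0, [::]|exists c0, c1, c2, cs];
    split; rewrite ?big_cons ?big_nil /=; lia.
rewrite [binary_value _]/= !expnS /=.
set V := binary_value cs' => valE.
(* The carry out of the two lowest digits, read off the upper digits. *)
pose t' := alternating_bits m' + (2 ^ m')%N%:Z * t - (c2 + 2 * V).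
have t'E : c0 + 2 * c1 = 1 + 4 * t' by rewrite /t'; lia.
have := IHk m' ((c2 + t') :: cs') t; rewrite big_cons /= -/V.
rewrite big_cons => /(_ (ltnW le_mk)) H.
have {}H : (uphalf m' <= `|(c2 + t')%R| + \sum_(j <- cs') `|j|)%N.
  by apply: H; rewrite /t'; lia.
lia.
Qed.

(** Peeling off base 4 digits: the digits [-1], [1] and [2] are single signed
    powers of two, and when [m] is odd the last binary digit costs one more. *)
Lemma short_signed_repr m (z : int) : exists (L : seq (bool * nat)) (t : int),
  [/\ (size L <= uphalf m)%N, all (fun l => l.2 < m)%N L
    & z = \sum_(l <- L) (-1) ^+ l.1 * (2 ^ l.2)%N%:Z + (2 ^ m)%N%:Z * t].
Proof.
suff H : forall k m (z : int), (m <= k)%N ->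
  exists (L : seq (bool * nat)) (t : int),
  [/\ (size L <= uphalf m)%N, all (fun l => l.2 < m)%N L
    & z = \sum_(l <- L) (-1) ^+ l.1 * (2 ^ l.2)%N%:Z + (2 ^ m)%N%:Z * t].
  by apply: (H m).
elim=> [|k IHk] [|[|m']] {}z // le_mk.
- by exists [::], z; rewrite big_nil; split => //; lia.
- by exists [::], z; rewrite big_nil; split => //; lia.
- have [z_even|z_odd] : z = 2 * (z %/ 2)%Z \/ z = 1 + 2 * (z %/ 2)%Z by lia.
    by exists [::], (z %/ 2)%Z; rewrite big_nil; split => //; lia.
  by exists [:: (false, 0%N)], (z %/ 2)%Z; rewrite big_seq1 /=; split => //; lia.
(* The shift by 1 makes the remainder z - 4 q lie in {-1, 0, 1, 2}. *)
pose q := ((z + 1) %/ 4)%Z.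
have [L [t [szL ltL qE]]] := IHk m' q (ltnW le_mk).
pose L4 := [seq (l.1, l.2.+2) | l <- L].
have L4E : \sum_(l <- L4) (-1) ^+ l.1 * (2 ^ l.2)%N%:Z
    = 4 * \sum_(l <- L) (-1) ^+ l.1 * (2 ^ l.2)%N%:Z :> int.
  rewrite big_map mulr_sumr; apply: eq_bigr => l _ /=.
  by rewrite !expnS !PoszM; ring.
have ltL4 : all (fun l => l.2 < m'.+2)%N L4.
  by rewrite all_map; apply: sub_all ltL.
have szL4 : size L4 = size L by rewrite size_map.
have digit : [\/ z = 4 * q, z = 4 * q + 1, z = 4 * q + 2 | z = 4 * q - 1].
  have : z = 4 * q \/ z = 4 * q + 1 \/ z = 4 * q + 2 \/ z = 4 * q - 1.
    by rewrite /q; lia.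
  by case=> [|[|[|]]]; [constructor 1|constructor 2|constructor 3|constructor 4].
case: digit => zE; [exists L4, t|exists ((false, 0%N) :: L4), t|
  exists ((false, 1%N) :: L4), t|exists ((true, 0%N) :: L4), t];
  rewrite ?big_cons L4E /= szL4 ltL4 !expnS; split=> //; try lia;
  by rewrite zE qE !PoszM ?expn0; ring.
Qed.

(** * The diameter *)

Lemma modn_lt_double a d : (a < d + d)%N ->
  (a %% d = if (a < d)%N then a else a - d)%N.
Proof.
move=> lt_a; case: ltnP => [|le_da]; first exact: modn_small.
by rewrite -{1}(subnK le_da) modnDr modn_small //; lia.
Qed.

Section Diameter.
Variables (R : realType) (m : nat).
Hypothesis m_ge2 : (2 <= m)%N.
Local Notation n := (2 ^ m)%N.
Local Notation e := (Gex R m).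

Lemma double_exp2_le (r : 'I_m) : (0 < 2 ^ r /\ 2 ^ r + 2 ^ r <= n)%N.
Proof.
by rewrite expn_gt0 addnn -mul2n -expnS leq_exp2l.
Qed.

Lemma GexE i j : e i j = [exists r : 'I_m,
  (val i == (j + 2 ^ r) %% n)%N || (val j == (i + 2 ^ r) %% n)%N].
Proof.
have c_gt0 : 0 < (2 * m%:R)^-1 :> R by rewrite invr_gt0 mulr_gt0 // ltr0n ltnW.
rewrite /Gex /support_graph /= Wex_entry // pmulr_rgt0 //.
apply/andP/existsP => [[_]|[r ij]].
  rewrite lt0r psumr_neq0 => [/andP[/hasP[r _ ij] _]|r _];
    last by rewrite addr_ge0.
  exists r; move: ij => /=; do 2!case: eqP => //=.
  by rewrite mulr0n addr0 ltxx.
have [r_gt0 r_le] := double_exp2_le r; split.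
  apply/eqP => ijE; move: ij; rewrite {}ijE orbb => /eqP /=.
  have lt_j := ltn_ord j.
  by rewrite modn_lt_double; [case: ltnP|]; lia.
rewrite lt0r psumr_neq0 => [|s _]; last by rewrite addr_ge0.
rewrite sumr_ge0 ?andbT => [|s _]; last by rewrite addr_ge0.
apply/hasP; exists r; rewrite ?mem_index_enum //=.
by case/orP: ij => ->; [apply: ltr_pwDl | apply: ltr_pwDr];
  rewrite ?ltr01 ?ler0n.
Qed.

(** As [2 ^ r] is at most half of [2 ^ m], the residue [2 ^ r] is always the
    smaller of the two residues compared by the cyclic distance. *)
Lemma Gex_cyclic_dist i j :
  e i j = [exists r : 'I_m, cyclic_dist i j == 2 ^ r]%N.
Proof.
rewrite GexE; apply: eq_existsb => r; rewrite /cyclic_dist.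
have [r_gt0 r_le] := double_exp2_le r.
have [lt_i lt_j] := (ltn_ord i, ltn_ord j).
rewrite modn_lt_double; last by lia.
rewrite modn_lt_double; last by lia.
rewrite modn_lt_double; last by lia.
rewrite modn_lt_double; last by lia.
rewrite /=; do 4![case: ltnP => ?]; apply/idP/idP; lia.
Qed.

(** A negative step [- 2 ^ r] is realised by adding [2 ^ m - 2 ^ r]. *)
Lemma Gex_step (u : 'I_n) (s : bool) r : (r < m)%N ->
  exists (w : 'I_n) (t : int),
  e u w /\ w%:Z = u%:Z + (-1) ^+ s * (2 ^ r)%N%:Z + n%:Z * t.
Proof.
move=> lt_rm; have [r_gt0 r_le] := double_exp2_le (Ordinal lt_rm).
rewrite /= in r_gt0 r_le; have lt_u := ltn_ord u.
have [d dE] : {d | d = if s then n - 2 ^ r else 2 ^ r}%N by eexists.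
have lt_w : ((u + d) %% n < n)%N by rewrite ltn_mod expn_gt0.
exists (Ordinal lt_w), (s%:Z - ((u + d) %/ n)%N%:Z); split; last first.
  have dZ : d%:Z = (-1) ^+ s * (2 ^ r)%N%:Z + n%:Z * s%:Z.
    by rewrite dE; case: (s) => /=; lia.
  have := divn_eq (u + d) n; rewrite /=; lia.
rewrite GexE; apply/existsP; exists (Ordinal lt_rm) => /=.
rewrite modnDml; case: (s) dE => ->; last by rewrite eqxx orbT.
rewrite -addnA subnK; last by lia.
by rewrite modnDr modn_small ?eqxx.
Qed.

Lemma Gex_step_inv (u w : 'I_n) : e u w ->
  exists (s : bool) (r : nat) (t : int),
  w%:Z = u%:Z + (-1) ^+ s * (2 ^ r)%N%:Z + n%:Z * t.
Proof.
rewrite GexE => /existsP[r /orP[] /eqP uw].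
  exists true, (val r), ((w + 2 ^ r) %/ n)%N%:Z.
  by have := divn_eq (w + 2 ^ r) n; rewrite -uw /=; lia.
exists false, (val r), (- ((u + 2 ^ r) %/ n)%N%:Z).
by have := divn_eq (u + 2 ^ r) n; rewrite -uw /=; lia.
Qed.

Lemma walk_along (L : seq (bool * nat)) (u : 'I_n) :
  all (fun l => l.2 < m)%N L ->
  exists (p : seq 'I_n) (t : int), [/\ size p = size L, path e u p &
   (last u p)%:Z = u%:Z + \sum_(l <- L) (-1) ^+ l.1 * (2 ^ l.2)%N%:Z + n%:Z * t].
Proof.
elim: L u => [|l L IHL] u /=.
  by exists [::], 0; rewrite big_nil mulr0 !addr0.
case/andP => lt_lm ltL.
have [w [t [uw wE]]] := Gex_step u l.1 lt_lm.
have [p [t' [szp wp lE]]] := IHL w ltL.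
exists (w :: p), (t + t'); rewrite /= szp uw wp lE wE big_cons; split=> //.
ring.
Qed.

Lemma walk_weight (u : 'I_n) p : path e u p -> exists (cs : seq int) (t : int),
  (last u p)%:Z = u%:Z + binary_value cs + n%:Z * t /\ (weight cs <= size p)%N.
Proof.
elim: p u => [|w p IHp] u /=.
  by exists [::], 0; rewrite mulr0 !addr0 /weight big_nil.
case/andP=> /Gex_step_inv[s [r [t wE]]] /IHp[cs [t' [lE wt_cs]]].
have [cs' [cs'E wt_cs']] := binary_value_add s r cs.
exists cs', (t + t'); split; last exact: leq_trans wt_cs' _.
by rewrite lE wE cs'E; ring.
Qed.

Lemma ord_repr (z : int) : exists (v : 'I_n) (t : int), v%:Z = z + n%:Z * t.
Proof.
have n_neq0 : n%:Z != 0 by rewrite eqz_nat -lt0n expn_gt0.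
have lt_v : (`|(z %% n%:Z)%Z|%N < n)%N.
  by rewrite -ltz_nat gez0_abs ?modz_ge0 // ltz_pmod // ltz_nat expn_gt0.
exists (Ordinal lt_v), (- (z %/ n%:Z)%Z) => /=.
by rewrite gez0_abs ?modz_ge0 // {2}(divz_eq z n%:Z); ring.
Qed.

(** For the lower bound the two vertices are 0 and the residue of
    [alternating_bits m]. *)
Lemma diameter_Gex : diameter e = uphalf m.
Proof.
apply/eqP; rewrite eqn_leq; apply/andP; split.
  apply/bigmax_leqP => u _; apply/bigmax_leqP => v _.
  have [L [t [szL ltL vE]]] := short_signed_repr m (v%:Z - u%:Z).
  have [p [t' [szp up lE]]] := walk_along u ltL.
  apply: leq_trans szL; rewrite -szp; apply: graph_dist_le => //.
  apply: val_inj => /=; have [lt_l lt_v] := (ltn_ord (last u p), ltn_ord v).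
  have diffE : (last u p)%:Z - v%:Z = n%:Z * (t' - t).
    by rewrite lE -[v%:Z](subrK u%:Z) vE; ring.
  have [tt'|[tt'|tt']] : t' - t = 0 \/ t' - t >= 1 \/ t' - t <= -1 by lia.
  - by move: diffE; rewrite tt' mulr0; lia.
  - have : n%:Z * 1 <= n%:Z * (t' - t) by rewrite ler_wpM2l.
    by rewrite -diffE; lia.
  - have : n%:Z * (t' - t) <= n%:Z * (-1) by rewrite ler_wpM2l.
    by rewrite -diffE; lia.
have n_gt0 : (0 < n)%N by rewrite expn_gt0.
pose u : 'I_n := Ordinal n_gt0.
have [v [t vE]] := ord_repr (alternating_bits m).
apply: leq_trans (leq_bigmax u); apply: leq_trans (leq_bigmax v).
apply: graph_dist_ge => [|p up lE].
  rewrite card_ord; apply: leq_trans (ltnW (ltn_expl m (isT : 1 < 2)%N)); lia.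
have [cs [t' [lE' wt_cs]]] := walk_weight up.
apply: leq_trans wt_cs; apply: (@weight_alternating_bits m cs (t - t')).
by move: lE'; rewrite lE vE /= mulrBr; lia.
Qed.

End Diameter.

(** * Asymptotics *)

Lemma uphalf_ceil (R : realType) (m : nat) :
  (uphalf m)%:Z = Num.ceil (m%:R / 2 : R).
Proof.
apply/esym/ceil_def; rewrite intrB /= -pmulrn uphalf_half.
have mE : m%:R = (odd m)%:R + 2 * (m./2)%:R :> R.
  by rewrite -{1}(odd_double_half m) natrD -mul2n natrM.
rewrite natrD [in X in _ < X]mE [in X in _ && X]mE.
by case: odd; rewrite /=; apply/andP; split; lra.
Qed.

Lemma eqTheta_of_bounds (R : realType) (f g : nat -> R) (a b : R) :
  0 < a -> 0 < b ->
  (forall k, (2 <= k)%N -> [/\ 0 <= g k, a * g k <= f k & f k <= b * g k]) ->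
  f =Theta_\oo g.
Proof.
move=> a_gt0 b_gt0 bounds; rewrite eqThetaE; apply/asboolP.
exists (a, b); first by rewrite /= a_gt0.
near=> k.
have k_ge2 : (2 <= k)%N by near: k; exists 2%N.
have [g_ge0 le_gf le_fg] := bounds k k_ge2.
have f_ge0 : 0 <= f k by apply: le_trans le_gf; rewrite mulr_ge0 // ltW.
by rewrite /= !ger0_norm // le_gf le_fg.
Unshelve. all: by end_near.
Qed.

(** Inverses of the two bounds [1 / m <= 1 - lambda <= 2 / m]. *)
Lemma tau_Wex_bounds (R : realType) (m : nat) : (2 <= m)%N ->
  m%:R / 2 <= tau (Wex R m) <= m%:R.
Proof.
move=> m_ge2; have m_ge2R : 2 <= m%:R :> R by rewrite ler_nat.
have m_gt0 : 0 < m%:R :> R by lra.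
have lo := lambda_Wex_ge R m_ge2; have hi := lambda_Wex_le R m_ge2.
have gap_ge : m%:R^-1 <= 1 - lambda (Wex R m).
  have hiE : (m%:R - 1) / m%:R = 1 - m%:R^-1 :> R by field; rewrite gt_eqF.
  by move: hi; rewrite hiE; lra.
have gap_le : 1 - lambda (Wex R m) <= 2 / m%:R.
  have loE : (m%:R - 2) / m%:R = 1 - 2 / m%:R :> R by field; rewrite gt_eqF.
  by move: lo; rewrite loE; lra.
have gap_gt0 : 0 < 1 - lambda (Wex R m).
  by rewrite (lt_le_trans _ gap_ge) ?invr_gt0.
rewrite /tau div1r; apply/andP; split.
  by rewrite -invf_div lef_pV2 ?posrE // divr_gt0.
by rewrite -[leRHS]invrK lef_pV2 ?posrE ?invr_gt0.
Qed.

Lemma diameter_Gex_bounds (R : realType) (m : nat) : (2 <= m)%N ->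
  m%:R / 2 <= ((diameter (Gex R m))%:R : R) <= m%:R.
Proof.
move=> m_ge2; rewrite diameter_Gex // ler_pdivrMr // -natrM !ler_nat.
by apply/andP; split; lia.
Qed.

Unset Implicit Arguments.

Theorem lemma2p3 (R : realType) :
  (forall m : nat, (2 <= m)%N ->
    [/\ (Wex R m)^T = Wex R m,
        doubly_stochastic (Wex R m),
        (forall i j : 'I_(2 ^ m),
          Gex R m i j = [exists r : 'I_m, cyclic_dist i j == 2 ^ r]%N),
        (diameter (Gex R m))%:Z = Num.ceil (m%:R / 2 : R)
      & 1 - 2 / m%:R <= lambda (Wex R m) <= 1 - (2 - Num.sqrt 2) / m%:R]) /\
  [/\ (fun m : nat => (diameter (Gex R m))%:R : R)
        =Theta_\oo (fun m : nat => ln (2 ^ m)%N%:R : R),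
      (fun m : nat => tau (Wex R m)) =Theta_\oo (fun m : nat => m%:R : R),
      (fun m : nat => tau (Wex R m))
        =Theta_\oo (fun m : nat => ln (2 ^ m)%N%:R : R)
    & (fun m : nat => tau (Wex R m))
        =Theta_\oo (fun m : nat => (diameter (Gex R m))%:R : R)].
Proof.
split.
  move=> m m_ge2; have m_gt0 : 0 < m%:R :> R by rewrite ltr0n ltnW.
  split.
  - exact: Wex_sym.
  - exact: Wex_doubly_stochastic.
  - exact: Gex_cyclic_dist.
  - by rewrite diameter_Gex // (uphalf_ceil R).
  apply/andP; split.
    rewrite (_ : 1 - _ = (m%:R - 2) / m%:R); first exact: lambda_Wex_ge.
    by field; rewrite gt_eqF.
  apply: le_trans (lambda_Wex_le R m_ge2) _.
  have sqrt2_ge1 : 1 <= Num.sqrt 2 :> R by rewrite -{1}sqrtr1 ler_sqrt ?ler1n.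
  rewrite (_ : 1 - _ = (m%:R - (2 - Num.sqrt 2)) / m%:R).
    by rewrite ler_pM2r ?invr_gt0 //; lra.
  by field; rewrite gt_eqF.
have ln2_gt0 : 0 < ln 2 :> R by rewrite ln_gt0 // ltr1n.
have lnE m : ln (2 ^ m)%N%:R = m%:R * ln 2 :> R.
  by rewrite natrX lnXn // mulr_natl.
have ln2_neq0 : ln 2 != 0 :> R by rewrite gt_eqF.
have lo m : (2 * ln 2)^-1 * ln (2 ^ m)%N%:R = m%:R / 2 :> R.
  by rewrite lnE; field.
have hi m : (ln 2)^-1 * ln (2 ^ m)%N%:R = m%:R :> R by rewrite lnE; field.
have ln_ge0 m : 0 <= ln (2 ^ m)%N%:R :> R by rewrite lnE mulr_ge0 // ltW.
split.
- apply: (@eqTheta_of_bounds R _ _ (2 * ln 2)^-1 (ln 2)^-1) => [||m m_ge2].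
  + by rewrite invr_gt0 mulr_gt0.
  + by rewrite invr_gt0.
  + by have /andP[] := diameter_Gex_bounds R m_ge2; rewrite lo hi.
- apply: (@eqTheta_of_bounds R _ _ 2^-1 1) => // m m_ge2.
  by have /andP[] := tau_Wex_bounds R m_ge2; rewrite mul1r mulrC.
- apply: (@eqTheta_of_bounds R _ _ (2 * ln 2)^-1 (ln 2)^-1) => [||m m_ge2].
  + by rewrite invr_gt0 mulr_gt0.
  + by rewrite invr_gt0.
  + by have /andP[] := tau_Wex_bounds R m_ge2; rewrite lo hi.
- apply: (@eqTheta_of_bounds R _ _ 2^-1 2) => // m m_ge2.
  have /andP[d_lo d_hi] := diameter_Gex_bounds R m_ge2.
  have /andP[t_lo t_hi] := tau_Wex_bounds R m_ge2.
  by split; [exact: ler0n|lra|lra].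
Qed.
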